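(* Let $(\mathbb{X},\mathcal{M})$ be a measurable space and let $\mathcal{N}\subseteq\mathcal{M}$ be a family of measurable sets. If $\mu$ is a $\sigma$-finite measure defined on $\mathcal{M}$, then $\mu$ can be uniquely written as $$\mu=\mu_{\mathcal{N}}+\mu_{\mathcal{N}}^{\perp},$$ where $\mu_{\mathcal{N}}$ and $\mu_{\mathcal{N}}^{\perp}$ are measures defined on $\mathcal{M}$ such that $\mu_{\mathcal{N}}$ is carried by $\mathcal{N}$ and $\mu_{\mathcal{N}}^{\perp}$ is singular to $\mathcal{N}$. Moreover, there exists $A_\mu\in\mathcal{M}$, which is a countable union of sets in $\mathcal{N}$, such that $$\mu_{\mathcal{N}}=\mu\llcorner A_\mu,\qquad \mu_{\mathcal{N}}^{\perp}=\mu\llcorner(\mathbb{X}\setminus A_\mu).$$ The measure $\mu$ is carried by $\mathcal{N}$ if and only if $\mu=\mu_{\mathcal{N}}$; and, similarly, $\mu$ is singular to $\mathcal{N}$ if and only if $\mu=\mu_{\mathcal{N}}^{\perp}$.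
   Context: A measurable space $(\mathbb{X},\mathcal{M})$ is a nonempty set $\mathbb{X}$ equipped with a $\sigma$-algebra $\mathcal{M}$ of subsets of $\mathbb{X}$. A measure is a positive measure, i.e. a function $\mu:\mathcal{M}\to[0,\infty]$ with $\mu(\emptyset)=0$ that is countably additive on disjoint sets. A measure $\mu$ is $\sigma$-finite if $\mathbb{X}=\bigcup_{i=1}^\infty X_i$ for some sets $X_i\in\mathcal{M}$ with $\mu(X_i)<\infty$ for all $i$. For a measure $\mu$ on $\mathcal{M}$ and a family $\mathcal{N}\subseteq\mathcal{M}$: (1) $\mu$ is carried by $\mathcal{N}$ if there exist countably many $N_i\in\mathcal{N}$ such that $\mu(\mathbb{X}\setminus\bigcup_i N_i)=0$; (2) $\mu$ is singular to $\mathcal{N}$ if $\mu(N)=0$ for every $N\in\mathcal{N}$. Here ''countable'' means finite (possibly zero) or countably infinite. For $A\in\mathcal{M}$, the restriction $\mu\llcorner A$ is the measure defined by $(\mu\llcorner A)(B)=\mu(A\cap B)$ for all $B\in\mathcal{M}$. *)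

(* Defs.v *)
From mathcomp Require Import all_boot all_order all_algebra.
From mathcomp Require Import all_classical all_reals all_analysis.

Set Implicit Arguments.
Unset Strict Implicit.
Unset Printing Implicit Defensive.

Import Order.TTheory GRing.Theory Num.Theory.

Local Open Scope classical_set_scope.
Local Open Scope ring_scope.
Local Open Scope ereal_scope.

(* [countable] covers finite and empty families, so [A] may be [set0]. *)
Definition countable_union_of (T : Type) (N : set (set T)) (A : set T) : Prop :=
  exists F : set (set T), [/\ F `<=` N, countable F & A = \bigcup_(B in F) B].

Section carried_singular.
Context d (T : measurableType d) (R : realType).
Implicit Types (mu nu : set T -> \bar R) (N : set (set T)).

(* A [{measure set T -> \bar R}] is only constrained to be nonnegative on
   non-measurable sets, so equality of measures is equality on measurable
   sets. *)
Definition eq_meas mu nu : Prop := forall A, measurable A -> mu A = nu A.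

Definition carried_by N mu : Prop :=
  exists F : set (set T),
    [/\ F `<=` N, countable F & mu (~` \bigcup_(B in F) B) = 0].

Definition singular_to N mu : Prop := forall B, N B -> mu B = 0.

Definition is_decomposition N mu (nu1 nu2 : {measure set T -> \bar R}) : Prop :=
  [/\ eq_meas mu (measure_add nu1 nu2), carried_by N nu1 & singular_to N nu2].

End carried_singular.

(* Main.v *)
Require Import Defs.
From mathcomp Require Import all_boot all_order all_algebra.
From mathcomp Require Import all_classical all_reals all_analysis.

Import Order.TTheory.

Local Open Scope classical_set_scope.
Local Open Scope ring_scope.
Local Open Scope ereal_scope.

(** The decomposition is a restriction to a largest countable union of members
    of the family. Call a set in [N] negligible off [A] when [mu (B `\` A) = 0].
    If a countable union [A] of sets in [N] has every [B] in [N] negligible off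
    it, then [mu] restricted to [A] is carried by [N] and [mu] restricted to
    the complement of [A] is singular to [N].

    Such an [A] is found by exhaustion ([exhausting_countable_union]). On a set
    [X] of finite measure, the supremum of [mu (A `&` X)] over countable unions
    [A] is attained, because countable unions are closed under countable
    unions; adding one more [B] to a maximizer cannot increase the measure, and
    finiteness turns this into [mu ((B `\` A) `&` X) = 0]. By sigma-finiteness
    countably many such [X] cover the space, and the union of the corresponding
    maximizers works everywhere.

    Uniqueness holds because [A] separates the parts of any decomposition
    [mu = nu1 + nu2]: [nu2 A = 0] since [A] is a countable union of sets in [N],
    and [nu1 (~` A) = 0] since [nu1] lives on a countable union of sets in [N],
    each negligible off [A] ([carried_by_setC0]). A pair of measures so
    separated by [A] consists of the two restrictions of the sum
    ([separated_sum_mrestr]). The two equivalences use the same facts. *)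

Lemma bigcup_countable_measurable {d} {T : measurableType d}
    (F : set (set T)) :
  countable F -> F `<=` measurable -> measurable (\bigcup_(B in F) B).
Proof.
move=> /pfcard_geP[->|[f]] Fm; first by rewrite bigcup_set0.
rewrite -(image_eq f) bigcup_image; apply: bigcup_measurable => n _.
by apply: Fm; exact: funS.
Qed.

Lemma negligible_bigcup_countable {d} {T : measurableType d} {R : realType}
    (mu : {measure set T -> \bar R}) {I : Type} (F : set I) (G : I -> set T) :
  countable F -> (forall i, F i -> mu.-negligible (G i)) ->
  mu.-negligible (\bigcup_(i in F) G i).
Proof.
move=> /pfcard_geP[->|[f]] F0.
  by rewrite bigcup_set0; exact: negligible_set0.
rewrite -(image_eq f) bigcup_image; apply: negligible_bigcup => n.
by apply: F0; exact: funS.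
Qed.

Lemma countable_union_of_measurable {d} {T : measurableType d}
    (N : set (set T)) (A : set T) :
  N `<=` measurable -> countable_union_of N A -> measurable A.
Proof.
move=> mN [F [FN cF ->]]; apply: bigcup_countable_measurable => //.
exact: subset_trans mN.
Qed.

Lemma countable_union_of_bigcup {T : Type} (N : set (set T))
    (A : nat -> set T) :
  (forall n, countable_union_of N (A n)) -> countable_union_of N (\bigcup_n A n).
Proof.
move=> /choice[F FA]; exists (\bigcup_n F n); split.
- by apply: bigcup_sub => n _; have [] := FA n.
- by apply: bigcup_countable => // n _; have [] := FA n.
- by rewrite bigcup_bigcup; apply: eq_bigcupr => n _; have [] := FA n.
Qed.

Lemma countable_union_ofU1 {T : Type} (N : set (set T)) (A B : set T) :
  countable_union_of N A -> N B -> countable_union_of N (A `|` B).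
Proof.
move=> NA NB.
suff -> : A `|` B = \bigcup_n (if n is 0%N then A else B).
  apply: countable_union_of_bigcup => -[//|n].
  exists [set B]; split; [by move=> _ ->|exact: countable1|].
  by rewrite bigcup_set1.
apply/seteqP; split=> [x [Ax|Bx]|x [[|n] _ ?]]; [by exists 0%N|by exists 1%N| |].
- by left.
- by right.
Qed.

(** The supremum of [mu (A `&` X)] over countable unions [A] is attained at the
    union of a maximizing sequence; finiteness of [mu X] allows subtracting. *)
Lemma exhausting_countable_union_fin {d} {T : measurableType d}
    {R : realType} (mu : {measure set T -> \bar R}) (N : set (set T))
    (X : set T) :
  N `<=` measurable -> measurable X -> mu X < +oo ->
  exists2 A, countable_union_of N A &
    forall B, N B -> mu ((B `\` A) `&` X) = 0.
Proof.
move=> mN mX Xoo.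
have mcu A := @countable_union_of_measurable _ _ N A mN.
pose S := [set mu (A `&` X) | A in countable_union_of N].
have S0 : S != set0.
  apply/set0P; exists (mu (set0 `&` X)), set0 => //.
  by exists set0; split; [exact: sub0set|exact: countable0|rewrite bigcup_set0].
have [u Su u_sup] := ereal_sup_seq S0.
have /choice[A_ A_u] n : exists A, countable_union_of N A /\ mu (A `&` X) = u n.
  by have [A NA <-] := Su n; exists A.
pose A := \bigcup_n A_ n.
have NA : countable_union_of N A.
  by apply: countable_union_of_bigcup => n; exact: (A_u n).1.
have mA := mcu _ NA; have mAX := measurableI _ _ mA mX.
have sup_le : ereal_sup S <= mu (A `&` X).
  apply: (cvge_to_le u_sup); apply: nearW => n; rewrite -(A_u n).2.
  apply: le_measure; rewrite ?inE//.
    by apply: measurableI => //; apply: mcu; exact: (A_u n).1.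
  by apply: setSI; exact: bigcup_sup.
exists A => // B NB; have mB := mN _ NB.
have mABX : measurable ((A `|` B) `&` X).
  by apply: measurableI => //; exact: measurableU.
have AX_fin : mu (A `&` X) \is a fin_num.
  rewrite ge0_fin_numE//; apply: le_lt_trans Xoo.
  by apply: le_measure; rewrite ?inE//; exact: subIsetr.
apply/eqP; rewrite eq_le measure_ge0 andbT.
have -> : (B `\` A) `&` X = ((A `|` B) `&` X) `\` (A `&` X).
  by apply/seteqP; split=> x /=; tauto.
rewrite measureD//; last first.
  apply: le_lt_trans Xoo.
  by apply: le_measure; rewrite ?inE//; exact: subIsetr.
rewrite (_ : _ `&` (A `&` X) = A `&` X); last first.
  by apply/seteqP; split=> x /=; tauto.
rewrite leeBlDr// add0e; apply: le_trans sup_le; apply: ereal_sup_ubound.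
by exists (A `|` B) => //; exact: countable_union_ofU1.
Qed.

Lemma exhausting_countable_union {d} {T : measurableType d} {R : realType}
    (mu : {measure set T -> \bar R}) (N : set (set T)) :
  N `<=` measurable -> sigma_finite [set: T] mu ->
  exists2 A, countable_union_of N A & forall B, N B -> mu (B `\` A) = 0.
Proof.
move=> mN [X X_cover X_fin].
have /choice[A_ A_max] n : exists A, countable_union_of N A /\
    forall B, N B -> mu ((B `\` A) `&` X n) = 0.
  have [mXn Xnoo] := X_fin n.
  by have [A] := exhausting_countable_union_fin mu N (X n) mN mXn Xnoo; exists A.
have NA_ n := (A_max n).1.
pose A := \bigcup_n A_ n.
have NA : countable_union_of N A by exact: countable_union_of_bigcup.
have mA := countable_union_of_measurable N A mN NA.
exists A => // B NB; have mB := mN _ NB.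
apply/negligibleP; first exact: measurableD.
rewrite -(setIT (B `\` A)) X_cover setI_bigcupr.
apply: negligible_bigcup => n.
apply: (@negligibleS _ _ _ _ ((B `\` A_ n) `&` X n)).
  by apply: setSI; apply: setDS; exact: bigcup_sup.
apply/negligibleP; last exact: (A_max n).2.
apply: measurableI; last exact: (X_fin n).1.
by apply: measurableD => //; exact: countable_union_of_measurable (NA_ n).
Qed.

(** Off [A], a measure carried by [N] lives on countably many sets
    [B `\` A] with [B] in [N]. *)
Lemma carried_by_setC0 {d} {T : measurableType d} {R : realType}
    (nu : {measure set T -> \bar R}) (N : set (set T)) (A : set T) :
  N `<=` measurable -> measurable A -> carried_by N nu ->
  (forall B, N B -> nu (B `\` A) = 0) -> nu (~` A) = 0.
Proof.
move=> mN mA [F [FN cF F0]] NA0.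
have mF := bigcup_countable_measurable F cF (subset_trans FN mN).
apply/negligibleP; first exact: measurableC.
apply: (@negligibleS _ _ _ _
  (~` (\bigcup_(B in F) B) `|` \bigcup_(B in F) (B `\` A))).
  move=> x Ax; have [[B FB Bx]|nFx] := pselect ((\bigcup_(B in F) B) x).
    by right; exists B.
  by left.
apply: negligibleU; first by apply/negligibleP => //; exact: measurableC.
apply: negligible_bigcup_countable => // B FB.
have mB := mN _ (FN _ FB).
by apply/negligibleP; [exact: measurableD|exact/NA0/FN].
Qed.

Lemma singular_to_countable_union {d} {T : measurableType d} {R : realType}
    (nu : {measure set T -> \bar R}) (N : set (set T)) (A : set T) :
  N `<=` measurable -> singular_to N nu -> countable_union_of N A -> nu A = 0.
Proof.
move=> mN nuN0 NA; have mA := countable_union_of_measurable N A mN NA.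
have [F [FN cF A_F]] := NA.
apply/negligibleP => //; rewrite A_F; apply: negligible_bigcup_countable => //.
move=> B FB; have NB := FN _ FB.
by apply/negligibleP; [exact: mN|exact: nuN0].
Qed.

Lemma measure_mrestr_conull {d} {T : measurableType d} {R : realType}
    (nu : {measure set T -> \bar R}) (A : set T) (mA : measurable A) :
  nu (~` A) = 0 -> eq_meas nu (mrestr nu mA).
Proof.
move=> nuA0 B mB; rewrite /mrestr (measureDI nu mB mA).
rewrite (@subset_measure0 _ _ _ nu (B `\` A) (~` A)) ?add0e//.
  exact: measurableD.
exact: measurableC.
Qed.

(** [nu1] equals its own restriction to [A], where [nu2] contributes nothing to
    the sum, and symmetrically on the complement of [A]. *)
Lemma separated_sum_mrestr {d} {T : measurableType d} {R : realType}
    (mu nu1 nu2 : {measure set T -> \bar R}) (A : set T) (mA : measurable A) :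
  eq_meas mu (measure_add nu1 nu2) -> nu1 (~` A) = 0 -> nu2 A = 0 ->
  eq_meas nu1 (mrestr mu mA) /\ eq_meas nu2 (mrestr mu (measurableC mA)).
Proof.
move=> mu12 nu1A nu2A; have mCA := measurableC mA.
split=> B mB; rewrite /mrestr mu12 ?measure_addE; try exact: measurableI.
- rewrite (measure_mrestr_conull nu1 A mA nu1A B mB) /mrestr.
  rewrite (@subset_measure0 _ _ _ nu2 (B `&` A) A) ?adde0//.
  exact: measurableI.
- have nu2CA : nu2 (~` ~` A) = 0 by rewrite setCK.
  rewrite (measure_mrestr_conull nu2 _ mCA nu2CA B mB) /mrestr.
  rewrite (@subset_measure0 _ _ _ nu1 (B `&` ~` A) (~` A)) ?add0e//.
  exact: measurableI.
Qed.

Theorem proposition1p3 (d : measure_display) (T : measurableType d)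
    (R : realType) (N : set (set T)) (mu : {measure set T -> \bar R})
    (hN : N `<=` measurable) (hmu : sigma_finite [set: T] mu) :
  exists muN muNperp : {measure set T -> \bar R},
    [/\ is_decomposition N mu muN muNperp,
        forall nu1 nu2 : {measure set T -> \bar R},
          is_decomposition N mu nu1 nu2 ->
          eq_meas nu1 muN /\ eq_meas nu2 muNperp,
        exists (A : set T) (mA : measurable A),
          [/\ countable_union_of N A,
              eq_meas muN (mrestr mu mA) &
              eq_meas muNperp (mrestr mu (measurableC mA))],
        carried_by N mu <-> eq_meas mu muN &
        singular_to N mu <-> eq_meas mu muNperp].
Proof.
have [A NA A_max] := exhausting_countable_union mu N hN hmu.
have mA := countable_union_of_measurable N A hN NA.
have mCA := measurableC mA.
exists (mrestr mu mA), (mrestr mu mCA).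
have carriedA (nu : {measure set T -> \bar R}) :
    nu (~` A) = 0 -> carried_by N nu.
  by have [F [FN cF ->]] := NA; exists F.
split.
- split.
  + move=> B mB; rewrite measure_addE/= /mrestr.
    by rewrite (measureDI mu mB mA) addeC setDE.
  + by apply: carriedA; rewrite /= /mrestr setICl measure0.
  + by move=> B NB /=; rewrite /mrestr -setDE A_max.
- move=> nu1 nu2 [mu12 nu1N nu2N]; apply: separated_sum_mrestr => //.
  + apply: (carried_by_setC0 nu1 N) => // B NB.
    have mBA : measurable (B `\` A) by apply: measurableD => //; exact: hN.
    (* [nu1] is dominated by [mu], so it vanishes where [mu] does. *)
    apply/eqP; rewrite eq_le measure_ge0 andbT -(A_max _ NB) mu12//.
    by rewrite measure_addE leeDl.
  + exact: singular_to_countable_union NA.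
- by exists A, mA; split.
- split=> [muN|mu_muN].
    apply: measure_mrestr_conull.
    exact: carried_by_setC0 A_max.
  by apply: carriedA; rewrite mu_muN// /= /mrestr setICl measure0.
- split=> [muN|mu_muNperp B NB].
    apply: measure_mrestr_conull; rewrite setCK.
    exact: singular_to_countable_union NA.
  by rewrite mu_muNperp; [rewrite /= /mrestr -setDE A_max|exact: hN].
Qed.
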